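(* Let $(V,|0\rangle,T,Y,\mathcal{S})$ be a braided state-field correspondence in which the hexagon relation $$\mathcal{S}(x)(Y(z)\otimes1)=(Y(z)\otimes1)\,\mathcal{S}^{23}(x)\,\iota_{x,z}\mathcal{S}^{13}(x+z)$$ holds. Then for all $a,b,c\in V$ and $f\in\mathbb{K}((z))[[h]]$, $$\mathcal{S}(x)(a_{(\lambda,f)}b\otimes c)=\sum_{l\ge0}\partial_\lambda^l\,\big((\cdot_{(\lambda,f)}\cdot)\otimes1\big)\,\mathcal{S}^{23}(x)\,\partial_x^{(l)}\mathcal{S}^{13}(x)(a\otimes b\otimes c)$$ $$=e^{\partial_\lambda\partial_{x_1}}\big((\cdot_{(\lambda,f)}\cdot)\otimes1\big)\,\mathcal{S}^{23}(x)\,\mathcal{S}^{13}(x_1)(a\otimes b\otimes c)\big|_{x_1=x}.$$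
   Context: $\mathbb{K}$ is a field of characteristic zero. A topologically free $\mathbb{K}[[h]]$-module is one isomorphic to $W[[h]]$ for a $\mathbb{K}$-vector space $W$; $U[[h]]\hat\otimes W[[h]]:=(U\otimes W)[[h]]$. $V_h((z))$ is the set of $a(z)\in V[[z,z^{-1}]]$ such that $a(z)\in V((z))$ modulo $h^M$ for every $M\ge0$. $\mathrm{Res}_z$ is the coefficient of $z^{-1}$. $\iota_{x,z}$ denotes expansion in the domain $|x|>|z|$ (nonnegative powers of $z$). A braided state-field correspondence $(V,|0\rangle,T,Y,\mathcal{S})$ consists of: a topologically free $\mathbb{K}[[h]]$-module $V$ with a nonzero vector $|0\rangle$ and a $\mathbb{K}[[h]]$-linear $T:V\to V$ with $T|0\rangle=0$; a $\mathbb{K}[[h]]$-linear map $Y:V\hat\otimes V\to V_h((z))$, written $Y(z)(a\otimes b)=Y(a,z)b=\sum_{n\in\mathbb{Z}}a_{(n)}b\,z^{-n-1}$, with $Y(z)(|0\rangle\otimes v)=v$, $Y(z)(v\otimes|0\rangle)\in v+V[[z]]z$ for all $v\in V$, and $\partial_zY(z)=TY(z)-Y(z)(1\otimes T)=Y(z)(T\otimes1)$; and a braiding, i.e. a $\mathbb{K}[[h]]$-linear map $\mathcal{S}(z):V\hat\otimes V\to V\hat\otimes V\hat\otimes(\mathbb{K}((z))[[h]])$ with $\mathcal{S}=1+O(h)$. $\mathcal{S}^{ij}$ denotes $\mathcal{S}$ acting in the $i$-th and $j$-th tensor factors (in this order), leaving the other factors unchanged. For $f\in\mathbb{K}((z))[[h]]$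 the $(\lambda,f)$-product is $a_{(\lambda,f)}b=\mathrm{Res}_z\,e^{\lambda z}f(z)Y(z)(a\otimes b)$, with values in $V\otimes\mathbb{K}[\lambda][[h]]$ ($h$-adically completed: polynomial in $\lambda$ with coefficients in $V$ modulo each $h^M$); $(\cdot_{(\lambda,f)}\cdot)\otimes1$ sends $u\otimes v\otimes w$ to $u_{(\lambda,f)}v\otimes w$. All maps are extended linearly over series in $x,x_1$ and polynomials in $\lambda$. Divided powers: $\partial_x^{(l)}=\partial_x^l/l!$; in the first formula $\partial_x^{(l)}$ acts only on $\mathcal{S}^{13}(x)$. *)

(* Defs.v *)
From HB Require Import structures.
From mathcomp Require Import all_boot all_order all_algebra generic_quotient.
From mathcomp Require Import boolp classical_sets functions cardinality fsbigop.

Set Implicit Arguments.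
Unset Strict Implicit.
Unset Printing Implicit Defensive.

Import Order.TTheory GRing.Theory Num.Theory.
Local Open Scope ring_scope.
Local Open Scope quotient_scope.

Section Tensor.
Context {K : fieldType} {U W : lmodType K}.

(* A list of pairs (u_i, w_i) stands for the sum of the u_i (x) w_i.  Two lists
   are identified when no bilinear map out of U x W separates them. *)
Definition tsum (X : lmodType K) (b : U -> W -> X) (s : seq (U * W)) : X :=
  \sum_(p <- s) b p.1 p.2.

Definition tequiv (s t : seq (U * W)) : bool :=
  `[< forall (X : lmodType K) (b : U -> W -> X),
        bilinear_for *:%R *:%R b -> tsum b s = tsum b t >].

Lemma tequivP s t : reflect (forall (X : lmodType K) (b : U -> W -> X),
  bilinear_for *:%R *:%R b -> tsum b s = tsum b t) (tequiv s t).
Proof. exact: asboolP. Qed.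

Lemma tequiv_refl : reflexive tequiv.
Proof. by move=> s; apply/tequivP. Qed.

Lemma tequiv_sym : symmetric tequiv.
Proof.
by move=> s t; apply/tequivP/tequivP => h X b bb; rewrite (h X b bb).
Qed.

Lemma tequiv_trans : transitive tequiv.
Proof.
move=> t s r /tequivP st /tequivP tr; apply/tequivP => X b bb.
by rewrite (st X b bb) (tr X b bb).
Qed.

Canonical tequiv_rel :=
  EquivRel tequiv tequiv_refl tequiv_sym tequiv_trans.

Definition tens : Type := {eq_quot tequiv}.
HB.instance Definition _ := Choice.on tens.
HB.instance Definition _ := Quotient.on tens.
HB.instance Definition _ : EqQuotient (seq (U * W)) tequiv tens :=
  EqQuotient.on tens.

(* The linear map induced by [b]; meaningful when [b] is bilinear (see [tliftE],
   [tlift_linear]). *)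
Definition tlift (X : lmodType K) (b : U -> W -> X) (t : tens) : X :=
  tsum b (repr t).

Lemma tlift_pi (X : lmodType K) (b : U -> W -> X) s :
  bilinear_for *:%R *:%R b -> tlift b (\pi_tens s) = tsum b s.
Proof.
move=> bb; have /eqmodP/tequivP : repr (\pi_tens s) = s %[mod tens].
  by rewrite reprK.
exact.
Qed.

Lemma tens_eq (t t' : tens) :
  (forall (X : lmodType K) (b : U -> W -> X), bilinear_for *:%R *:%R b ->
     tlift b t = tlift b t') -> t = t'.
Proof.
move=> h; rewrite -[t]reprK -[t']reprK; apply/eqmodP/tequivP => X b bb.
exact: h.
Qed.

Definition tzero : tens := \pi_tens [::].
Definition tadd (t t' : tens) : tens := \pi_tens (repr t ++ repr t').
Definition tscale (k : K) (t : tens) : tens :=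
  \pi_tens [seq (k *: p.1, p.2) | p <- repr t].
Definition topp (t : tens) : tens := tscale (-1) t.

Lemma tlift_tadd (X : lmodType K) (b : U -> W -> X) t t' :
  bilinear_for *:%R *:%R b -> tlift b (tadd t t') = tlift b t + tlift b t'.
Proof. by move=> bb; rewrite tlift_pi// /tsum big_cat. Qed.

Lemma tlift_tzero (X : lmodType K) (b : U -> W -> X) :
  bilinear_for *:%R *:%R b -> tlift b tzero = 0.
Proof. by move=> bb; rewrite tlift_pi// /tsum big_nil. Qed.

Lemma bilinear_scalel (X : lmodType K) (b : U -> W -> X) k u w :
  bilinear_for *:%R *:%R b -> b (k *: u) w = k *: b u w.
Proof.
move=> [bl _]; pose g := GRing.isLinear.Build _ _ _ _ _ (bl w).
pose F : {linear U -> X} := HB.pack (b ^~ w) g.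
exact: (linearZ_LR F).
Qed.

Lemma tlift_tscale (X : lmodType K) (b : U -> W -> X) k t :
  bilinear_for *:%R *:%R b -> tlift b (tscale k t) = k *: tlift b t.
Proof.
move=> bb; rewrite tlift_pi// /tlift /tsum big_map scaler_sumr.
by apply: eq_bigr => p _; rewrite /= bilinear_scalel.
Qed.

Fact taddA : associative tadd.
Proof. by move=> r s t; apply: tens_eq => X b bb; rewrite !tlift_tadd// addrA. Qed.
Fact taddC : commutative tadd.
Proof. by move=> s t; apply: tens_eq => X b bb; rewrite !tlift_tadd// addrC. Qed.
Fact tadd0 : left_id tzero tadd.
Proof.
by move=> t; apply: tens_eq => X b bb; rewrite tlift_tadd// tlift_tzero// add0r.
Qed.
Fact taddN : left_inverse tzero topp tadd.
Proof.
move=> t; apply: tens_eq => X b bb.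
by rewrite tlift_tadd// tlift_tzero// tlift_tscale// scaleN1r addNr.
Qed.

HB.instance Definition _ :=
  GRing.isZmodule.Build tens taddA taddC tadd0 taddN.

Fact tscaleA k l t : tscale k (tscale l t) = tscale (k * l) t.
Proof. by apply: tens_eq => X b bb; rewrite !tlift_tscale// scalerA. Qed.
Fact tscale1 : left_id 1 tscale.
Proof. by move=> t; apply: tens_eq => X b bb; rewrite tlift_tscale// scale1r. Qed.
Fact tscaleDr : right_distributive tscale +%R.
Proof.
move=> k s t; apply: tens_eq => X b bb; rewrite tlift_tscale//.
by rewrite !tlift_tadd// !tlift_tscale// scalerDr.
Qed.
Fact tscaleDl t : {morph tscale^~ t : k l / k + l}.
Proof.
move=> k l; apply: tens_eq => X b bb; rewrite tlift_tscale//.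
by rewrite !tlift_tadd// !tlift_tscale// scalerDl.
Qed.

HB.instance Definition _ :=
  GRing.Zmodule_isLmodule.Build K tens tscaleA tscale1 tscaleDr tscaleDl.

Definition tpure (u : U) (w : W) : tens := \pi_tens [:: (u, w)].

Lemma tpure_bilinear : bilinear_for *:%R *:%R tpure.
Proof.
by split=> [w k u u'|u k w w']; apply: tens_eq => X b bb;
  rewrite tlift_tadd// tlift_tscale// !tlift_pi// /tsum !big_seq1/=;
  case: bb => bl br; rewrite ?bl ?br.
Qed.

Lemma tliftE (X : lmodType K) (b : U -> W -> X) u w :
  bilinear_for *:%R *:%R b -> tlift b (tpure u w) = b u w.
Proof. by move=> bb; rewrite tlift_pi// /tsum big_seq1. Qed.

Lemma tlift_linear (X : lmodType K) (b : U -> W -> X) :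
  bilinear_for *:%R *:%R b -> linear (tlift b).
Proof. by move=> bb k s t; rewrite tlift_tadd// tlift_tscale. Qed.

Lemma tens_sum (t : tens) : t = \sum_(p <- repr t) tpure p.1 p.2.
Proof.
rewrite -{1}[t]reprK; elim: (repr t) => [|p s IHs]; first by rewrite big_nil.
rewrite big_cons -IHs; apply: tens_eq => X b bb.
by rewrite tlift_tadd// !tlift_pi// /tsum big_cons big_seq1.
Qed.

End Tensor.

Arguments tens {K} (U W)%_type_scope.

Notation "U ⊗ W" := (tens U W) (at level 40, left associativity) : type_scope.
Notation "u ⊗ w" := (tpure u w) (at level 40, left associativity) : ring_scope.

Section TensorMaps.
Context {K : fieldType}.
Implicit Types A B C D : lmodType K.

Definition tmap A B C D (f : A -> C) (g : B -> D) : A ⊗ B -> C ⊗ D :=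
  tlift (fun a b => f a ⊗ g b).

Definition tassoc A B C : A ⊗ B ⊗ C -> A ⊗ (B ⊗ C) :=
  tlift (fun ab c => tlift (fun a b => a ⊗ (b ⊗ c)) ab).

Definition tassocV A B C : A ⊗ (B ⊗ C) -> A ⊗ B ⊗ C :=
  tlift (fun a bc => tlift (fun b c => a ⊗ b ⊗ c) bc).

Definition tswap A B : A ⊗ B -> B ⊗ A := tlift (fun a b => b ⊗ a).

Definition tAC A B C : A ⊗ B ⊗ C -> A ⊗ C ⊗ B :=
  tlift (fun ab c => tlift (fun a b => a ⊗ c ⊗ b) ab).

End TensorMaps.

Arguments tassoc {K A B C}.
Arguments tassocV {K A B C}.
Arguments tswap {K A B}.
Arguments tAC {K A B C}.

Section Laurent.
Context {K : fieldType}.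

Definition bounded_below : {pred (int -> K^o)} := fun g : int -> K^o =>
  `[< exists N : int, forall n : int, n < N -> g n = 0 >].

Lemma bounded_belowP g :
  reflect (exists N : int, forall n : int, n < N -> g n = 0)
    (g \in bounded_below).
Proof. exact: asboolP. Qed.

Record laurent := Laurent { lcoef :> int -> K^o; _ : lcoef \in bounded_below }.
HB.instance Definition _ := [isSub for lcoef].
HB.instance Definition _ := [Choice of laurent by <:].

Lemma laurentP (g : laurent) : exists N : int, forall n : int, n < N -> g n = 0.
Proof. by apply/bounded_belowP; case: g. Qed.

Fact bounded_below_submod : submod_closed bounded_below.
Proof.
split=> [|k g g' /bounded_belowP[N gN] /bounded_belowP[N' gN']].
  by apply/bounded_belowP; exists 0.
apply/bounded_belowP; exists (Num.min N N') => n; rewrite lt_min => /andP[nN nN'].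
by rewrite !fctE gN// gN'// scaler0 addr0.
Qed.

HB.instance Definition _ :=
  GRing.isSubmodClosed.Build K (int -> K^o) bounded_below bounded_below_submod.
HB.instance Definition _ := [SubChoice_isSubLmodule of laurent by <:].

Fact lone_subproof : (fun n : int => (n == 0)%:R : K^o) \in bounded_below.
Proof. by apply/bounded_belowP; exists 0 => n n0; rewrite lt_eqF. Qed.
Definition lone : laurent := Laurent lone_subproof.

(* The sum over m has finite support, as does the one in [fY] below. *)
Fact lmul_subproof (g g' : laurent) :
  (fun n : int => \sum_(m \in [set: int]) (g m * g' (n - m)))
    \in bounded_below.
Proof.
have [N gN] := laurentP g; have [N' gN'] := laurentP g'.
apply/bounded_belowP; exists (N + N') => n nN; apply: fsbig1 => m _.
have [mN|Nm] := ltP m N; first by rewrite gN// mul0r.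
by rewrite gN' ?mulr0// ltrBlDl (lt_le_trans nN)// lerD2r.
Qed.
Definition lmul (g g' : laurent) : laurent := Laurent (lmul_subproof g g').

Fact lderiv_subproof (g : laurent) :
  (fun n : int => (n + 1)%:~R * g (n + 1)) \in bounded_below.
Proof.
have [N gN] := laurentP g.
apply/bounded_belowP; exists (N - 1) => n nN.
by rewrite gN ?mulr0// -ltrBrDr.
Qed.
Definition lderiv (g : laurent) : laurent := Laurent (lderiv_subproof g).

Definition gbinom (n : int) (l : nat) : K :=
  (\prod_(i < l) (n - i%:Z)%:~R) / (l`!)%:R.

(* The coefficient of z^l in iota_{x,z} g(x + z), a Laurent series in x:
   (x + z)^m is the sum over l >= 0 of binom(m, l) x^(m - l) z^l. *)
Fact liota_subproof (l : nat) (g : laurent) :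
  (fun n : int => gbinom (n + l%:Z) l * g (n + l%:Z))
    \in bounded_below.
Proof.
have [N gN] := laurentP g.
apply/bounded_belowP; exists (N - l%:Z) => n nN.
by rewrite gN ?mulr0// -ltrBrDr.
Qed.
Definition liota (l : nat) (g : laurent) : laurent :=
  Laurent (liota_subproof l g).

End Laurent.

Arguments laurent K : clear implicits.

(* A[[h]]; the n-th value is the coefficient of h^n.  The completed tensor
   product of A[[h]] and B[[h]] is {fps A ⊗ B}. *)
Notation "{ 'fps' A }" := (nat -> A) (at level 0, A at level 100) : type_scope.

Section HAdic.
Context {K : fieldType}.
Implicit Types A B C : lmodType K.

Definition hscale A (p : {fps K}) (s : {fps A}) : {fps A} :=
  fun n => \sum_(i < n.+1) p i *: s (n - i)%N.

Definition hlinear A B (F : {fps A} -> {fps B}) : Prop :=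
  forall (p : {fps K}) (s t : {fps A}),
    F (hscale p s + t) = hscale p (F s) + F t.

Definition hconst A (a : A) : {fps A} := fun n => if n is 0%N then a else 0.

Definition hmap A B (phi : A -> B) (t : {fps A}) : {fps B} :=
  fun n => phi (t n).

Definition htens A B (s : {fps A}) (t : {fps B}) : {fps A ⊗ B} :=
  fun n => \sum_(i < n.+1) s i ⊗ t (n - i)%N.

(* The K[[h]]-linear map with F(a) = sum_k (phi k a) h^k for a in A. *)
Definition hext A B (phi : nat -> A -> B) (t : {fps A}) : {fps B} :=
  fun n => \sum_(i < n.+1) phi (n - i)%N (t i).

(* F ⊗ 1 and 1 ⊗ F, for K[[h]]-linear F. *)
Definition htensr A B C (F : {fps A} -> {fps B}) : {fps A ⊗ C} -> {fps B ⊗ C} :=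
  hext (fun k => tmap (fun a => F (hconst a) k) id).

Definition htensl A B C (F : {fps A} -> {fps B}) : {fps C ⊗ A} -> {fps C ⊗ B} :=
  hext (fun k => tmap id (fun a => F (hconst a) k)).

(* The series with terms [u l] converges to [s] in the h-adic topology. *)
Definition hsum A (u : nat -> {fps A}) (s : {fps A}) : Prop :=
  forall M : nat, exists N : nat, forall n : nat, (N <= n)%N ->
    forall k : nat, (k < M)%N -> \sum_(l < n) u l k = s k.

(* e^D u = s, as an h-adically convergent exponential series. *)
Definition hexp A (D : {fps A} -> {fps A}) (u s : {fps A}) : Prop :=
  hsum (fun l : nat => (l`!)%:R^-1 *: iter l D u) s.

(* V_h((z)) inside V[[z, z^-1]]; [y n] is the coefficient of z^n. *)
Definition hlaurent A (y : int -> {fps A}) : Prop :=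
  forall M : nat, exists N : int, forall n : int, n < N ->
    forall k : nat, (k < M)%N -> y n k = 0.

End HAdic.

(* The topologically free module is V = W[[h]].  [sfY t n] is the coefficient
   of z^n in Y(z)(t), so that [sfY (htens a b) n] is a_(-n-1) b. *)
Record braided_sfc (K : fieldType) (W : lmodType K) := BraidedSFC {
  vac : {fps W};
  sfT : {fps W} -> {fps W};
  sfY : {fps W ⊗ W} -> int -> {fps W};
  sfS : {fps W ⊗ W} -> {fps W ⊗ W ⊗ laurent K};
  vac_neq0 : vac <> 0;
  sfT_linear : hlinear sfT;
  sfT_vac : sfT vac = 0;
  sfY_linear : forall n : int, hlinear (sfY^~ n);
  sfY_laurent : forall t : {fps W ⊗ W}, hlaurent (sfY t);
  sfY_vacl : forall (v : {fps W}) (n : int),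
    sfY (htens vac v) n = if n == 0 then v else 0;
  sfY_vacr_sing : forall (v : {fps W}) (n : int),
    n < 0 -> sfY (htens v vac) n = 0;
  sfY_vacr_cst : forall v : {fps W}, sfY (htens v vac) 0 = v;
  sfY_translation : forall (t : {fps W ⊗ W}) (n : int),
    sfT (sfY t n) - sfY (htensl sfT t) n = sfY t (n + 1) *~ (n + 1);
  sfY_derivation : forall (t : {fps W ⊗ W}) (n : int),
    sfY (htensr sfT t) n = sfY t (n + 1) *~ (n + 1);
  sfS_linear : hlinear sfS;
  sfS_1Oh : forall t : {fps W ⊗ W}, sfS t 0%N = t 0%N ⊗ lone
}.

Section BraidedSFC.
Context {K : fieldType} {W : lmodType K} (V : braided_sfc W).

Local Notation L := (laurent K).

Definition S23 (t : {fps W ⊗ W ⊗ W}) : {fps W ⊗ W ⊗ W ⊗ L} :=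
  hmap (fun u : W ⊗ (W ⊗ W ⊗ L) => tmap tassocV id (tassocV u))
       (htensl (sfS V) (hmap tassoc t)).

(* S^13 = P^12 S^23 P^12, with P^12 the flip of the first two factors. *)
Definition S13 (t : {fps W ⊗ W ⊗ W}) : {fps W ⊗ W ⊗ W ⊗ L} :=
  hmap (tmap (tmap tswap id) id)
       (S23 (hmap (tmap tswap id) t)).

(* S^23(x) acting on series in x1: the result is in two variables, the inner
   Laurent factor being that of x and the outer one that of x1. *)
Definition S23_ext : {fps W ⊗ W ⊗ W ⊗ L} -> {fps W ⊗ W ⊗ W ⊗ L ⊗ L} :=
  htensr S23.

(* The specialization x1 = x. *)
Definition diag (A : lmodType K) (u : A ⊗ L ⊗ L) : A ⊗ L :=
  tmap id (tlift lmul) (tassoc u).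

(* Coefficientwise in z^n.  The coefficient of z^l in iota_{x,z} S^13(x+z) is
   obtained by applying [liota l] to the Laurent factor of S^13(x). *)
Definition hexagon : Prop :=
  forall (t : {fps W ⊗ W ⊗ W}) (n : int),
    hsum (fun l : nat =>
            htensr (htensr (sfY V ^~ (n - l%:Z)))
              (hmap (@diag _) (S23_ext (hmap (tmap id (liota l)) (S13 t)))))
         (sfS V (htensr (sfY V ^~ n) t)).

(* The coefficient of z^p in f(z) Y(z)(t). *)
Definition fY (f : {fps L}) (t : {fps W ⊗ W}) (p : int) : {fps W} :=
  fun n => \sum_(i < n.+1)
    \sum_(m \in [set: int]) (f i m *: sfY V t (p - m) (n - i)%N).

(* Res_z e^(lambda z) f(z) Y(z)(t), whose coefficient of lambda^n / n! is
   Res_z z^n f(z) Y(z)(t); K[lambda] is {poly K}.  The sum over n is finite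
   modulo each power of h. *)
Definition lprod (f : {fps L}) (t : {fps W ⊗ W}) : {fps W ⊗ {poly K}} :=
  fun k => \sum_(n \in [set: nat])
    (fY f t (-1 - n%:Z) k ⊗ ((n`!)%:R^-1 *: 'X^n)).

(* Extends a map with values in polynomials in lambda by the identity of an
   extra factor C, keeping the factor K[lambda] last. *)
Definition lext (A B C : lmodType K) (F : {fps A} -> {fps B ⊗ {poly K}})
    (t : {fps A ⊗ C}) : {fps B ⊗ C ⊗ {poly K}} :=
  hmap tAC (htensr F t).

Definition dlambda (A : lmodType K) : A ⊗ {poly K} -> A ⊗ {poly K} :=
  tmap id (@deriv K).

Definition dx (A : lmodType K) : A ⊗ L -> A ⊗ L := tmap id lderiv.

End BraidedSFC.

Arguments diag {K A}.
Arguments dlambda {K A}.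
Arguments dx {K A}.

(* Main.v *)
From HB Require Import structures.
Require Import Defs.
From mathcomp Require Import all_boot all_order all_algebra.
From mathcomp Require Import boolp classical_sets functions cardinality fsbigop.

Set Implicit Arguments.
Unset Strict Implicit.
Unset Printing Implicit Defensive.

Import Order.TTheory GRing.Theory Num.Theory.
Local Open Scope ring_scope.

(* Write the (lambda,f)-product as sum_j lambda^j / j! times the coefficient of
   z^(-1-j) in f(z) Y(z).  Multiplication by f, followed by extraction of one
   coefficient, is an h-adically finite combination of coefficients, so it
   commutes with every K[[h]]-linear map, and applying it to the hexagon gives
     S(x) ((f Y)_p (a ⊗ b) ⊗ c)
       = sum_l ((f Y)_(p-l) ⊗ 1) S^23(x) d_x^(l) S^13(x) (a ⊗ b ⊗ c),
   because d_x^(l) S^13(x) is the coefficient of z^l in iota_{x,z} S^13(x+z).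
   For p = -1-j, the shift of p by l is the action of d_lambda^l on the
   coefficients of lambda^j / j!.  The second formula is the first one, with the
   specialization x_1 = x moved outside the exponential. *)

(** * Linear maps on algebraic tensor products *)

Section LinearMaps.
Context {K : fieldType}.
Implicit Types A B C D : lmodType K.

Lemma lin_sum A B (f : A -> B) (I : Type) (r : seq I) (P : pred I)
    (F : I -> A) : linear f ->
  f (\sum_(i <- r | P i) F i) = \sum_(i <- r | P i) f (F i).
Proof.
move=> lf; pose g := GRing.isLinear.Build _ _ _ _ _ lf.
pose f' : {linear A -> B} := HB.pack f g.
exact: (raddf_sum f').
Qed.

Lemma lin0 A B (f : A -> B) : linear f -> f 0 = 0.
Proof.
by move=> lf; have := lf (-1) 0 0; rewrite scaler0 addr0 scaleN1r addNr.
Qed.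

Lemma linZ A B (f : A -> B) k u : linear f -> f (k *: u) = k *: f u.
Proof. by move=> lf; have := lf k u 0; rewrite !addr0 lin0// addr0. Qed.

Lemma linD A B (f : A -> B) u v : linear f -> f (u + v) = f u + f v.
Proof. by move=> lf; have := lf 1 u v; rewrite !scale1r. Qed.

Lemma lin_comp A B C (f : B -> C) (g : A -> B) :
  linear f -> linear g -> linear (f \o g).
Proof. by move=> lf lg k u v /=; rewrite lg lf. Qed.

Lemma lin_id A : linear (@id A).
Proof. by []. Qed.

Lemma tpureDl A B (u u' : A) (w : B) : (u + u') ⊗ w = u ⊗ w + u' ⊗ w.
Proof. by have := (@tpure_bilinear K A B).1 w 1 u u'; rewrite /= !scale1r. Qed.

Lemma tpureZl A B k (u : A) (w : B) : (k *: u) ⊗ w = k *: (u ⊗ w).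
Proof. exact: bilinear_scalel tpure_bilinear. Qed.

Lemma tpure_linearl A B (w : B) : linear (fun u : A => u ⊗ w).
Proof. exact: tpure_bilinear.1. Qed.

Lemma tpure_linearr A B (u : A) : linear (fun w : B => u ⊗ w).
Proof. exact: tpure_bilinear.2. Qed.

Lemma tens_ext A B C (f g : A ⊗ B -> C) : linear f -> linear g ->
  (forall a b, f (a ⊗ b) = g (a ⊗ b)) -> f = g.
Proof.
move=> lf lg fg; apply/funext => t; rewrite [t]tens_sum !lin_sum//.
exact: eq_bigr.
Qed.

Lemma tens_ind A B (P : A ⊗ B -> Prop) :
  P 0 -> (forall s t, P s -> P t -> P (s + t)) -> (forall a b, P (a ⊗ b)) ->
  forall t, P t.
Proof.
by move=> P0 PD Pp t; rewrite [t]tens_sum; apply: big_ind => // p _; apply: Pp.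
Qed.

Lemma tmap_bilinear A B C D (f : A -> C) (g : B -> D) :
  linear f -> linear g -> bilinear_for *:%R *:%R (fun a b => f a ⊗ g b).
Proof.
move=> lf lg; split=> [b k a a'|a k b b'] /=.
  by rewrite lf tpure_linearl.
by rewrite lg tpure_linearr.
Qed.

Lemma tmapE A B C D (f : A -> C) (g : B -> D) a b :
  linear f -> linear g -> tmap f g (a ⊗ b) = f a ⊗ g b.
Proof. by move=> lf lg; rewrite /tmap tliftE//; apply: tmap_bilinear. Qed.

Lemma tmap_linear A B C D (f : A -> C) (g : B -> D) :
  linear f -> linear g -> linear (tmap f g).
Proof. by move=> lf lg; apply/tlift_linear/tmap_bilinear. Qed.

(** Linearity in [c] is checked term by term, since the representative of [t] does not depend on
    [c]. *)
Lemma tlift_bilinear A B C D (b : A -> B -> C -> D) :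
  (forall c, bilinear_for *:%R *:%R (fun x y => b x y c)) ->
  (forall x y, linear (b x y)) ->
  bilinear_for *:%R *:%R (fun t c => tlift (fun x y => b x y c) t).
Proof.
move=> b12 b3; split=> [c|t k c c'] /=.
  exact: tlift_linear (b12 c).
rewrite /tlift /tsum scaler_sumr -big_split/=; apply: eq_bigr => p _.
by rewrite b3.
Qed.

Lemma tassoc_bilinear A B C : bilinear_for *:%R *:%R
  (fun ab c => tlift (fun (a : A) (b : B) => a ⊗ (b ⊗ c : B ⊗ C)) ab).
Proof.
apply: (tlift_bilinear (b := fun a b c => a ⊗ (b ⊗ c))) => [c|a b].
  split=> [b|a]; first exact: tpure_linearl.
  exact: (lin_comp (tpure_linearr a) (tpure_linearl c)).
exact: (lin_comp (tpure_linearr a) (tpure_linearr b)).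
Qed.

Lemma tassocE A B C (a : A) (b : B) (c : C) :
  tassoc (a ⊗ b ⊗ c) = a ⊗ (b ⊗ c).
Proof.
rewrite /tassoc tliftE; last exact: tassoc_bilinear.
rewrite tliftE//; split=> [b'|a']; first exact: tpure_linearl.
exact: (lin_comp (tpure_linearr a') (tpure_linearl c)).
Qed.

Lemma tassoc_linear A B C : linear (@tassoc K A B C).
Proof. exact/tlift_linear/tassoc_bilinear. Qed.

Lemma tassocV_linear A B C : linear (@tassocV K A B C).
Proof.
apply/tlift_linear; split=> [bc|a].
  move=> k a a' /=; rewrite /tlift /tsum scaler_sumr -big_split/=.
  by apply: eq_bigr => p _; rewrite !tpure_linearl.
apply: tlift_linear; split=> [c|b] /=.
  exact: (lin_comp (tpure_linearl c) (tpure_linearr a)).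
exact: tpure_linearr.
Qed.

Lemma tAC_bilinear A B C : bilinear_for *:%R *:%R
  (fun ab c => tlift (fun (a : A) (b : B) => a ⊗ c ⊗ b : A ⊗ C ⊗ B) ab).
Proof.
apply: (tlift_bilinear (b := fun a b c => a ⊗ c ⊗ b)) => [c|a b].
  split=> [b|a]; last exact: tpure_linearr.
  exact: (lin_comp (tpure_linearl b) (tpure_linearl c)).
exact: (lin_comp (tpure_linearl b) (tpure_linearr a)).
Qed.

Lemma tACE A B C (a : A) (b : B) (c : C) : tAC (a ⊗ b ⊗ c) = a ⊗ c ⊗ b.
Proof.
rewrite /tAC tliftE; last exact: tAC_bilinear.
rewrite tliftE//; split=> [b'|a'] /=; last exact: tpure_linearr.
exact: (lin_comp (tpure_linearl b') (tpure_linearl c)).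
Qed.

Lemma tAC_linear A B C : linear (@tAC K A B C).
Proof. exact/tlift_linear/tAC_bilinear. Qed.

Lemma tmap_comp A B C A' B' C' (f : B -> C) (g : A -> B) (f' : B' -> C')
    (g' : A' -> B') : linear f -> linear g -> linear f' -> linear g' ->
  tmap f f' \o tmap g g' = tmap (f \o g) (f' \o g').
Proof.
move=> lf lg lf' lg'; apply: tens_ext => [||a b] /=.
- by apply: lin_comp; apply: tmap_linear.
- by apply: tmap_linear; apply: lin_comp.
- by rewrite !tmapE//; apply: lin_comp.
Qed.

End LinearMaps.

(** * Finitely supported sums and reindexing *)

Section FiniteSupport.

Lemma fsbigT_seq (T : choiceType) (A : zmodType) (r : seq T) (F : T -> A) :
  uniq r -> (forall x, x \notin r -> F x = 0) ->
  \sum_(x \in [set: T]) F x = \sum_(x <- r) F x.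
Proof.
move=> ur F0; rewrite (fsbigE r)//= => [|i _ /F0//].
by apply: eq_bigl => i; rewrite in_setT.
Qed.

Lemma fsbigZ_range (A : zmodType) (F : int -> A) (a : int) (d : nat) :
  (forall m, m < a -> F m = 0) -> (forall m, a + d%:Z <= m -> F m = 0) ->
  \sum_(m \in [set: int]) F m = \sum_(j < d) F (a + j%:Z).
Proof.
move=> Fl Fr; rewrite (@fsbigT_seq _ _ [seq a + j%:Z | j <- iota 0 d]).
- by rewrite big_map -{1}[d]subn0 -/(index_iota 0 d) big_mkord.
- rewrite map_inj_uniq ?iota_uniq// => i j /addrI; by case.
move=> m mr; have [/Fl//|am] := ltP m a.
have [/Fr//|md] := leP (a + d%:Z) m.
case/mapP: mr; exists `|m - a|%N.
  rewrite mem_iota /= add0n -ltz_nat gez0_abs ?subr_ge0//.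
  by rewrite ltrBlDl.
by rewrite gez0_abs ?subr_ge0// [RHS]addrC subrK.
Qed.

Lemma uniform_lbound (M : nat) (P : nat -> int -> Prop) :
  (forall i, exists N : int, forall n : int, n < N -> P i n) ->
  exists N : int, forall i, (i < M)%N -> forall n : int, n < N -> P i n.
Proof.
move=> h; elim: M => [|M [N IH]]; first by exists 0.
have [N' N'P] := h M; exists (Num.min N N') => i.
rewrite ltnS leq_eqVlt => /predU1P[->|iM] n; rewrite lt_min => /andP[nN nN'].
  exact: N'P.
exact: IH.
Qed.

(** Reassociates iterated Cauchy products; it underlies the K[[h]]-linearity of [hext] and the
    compatibility of [htensr] with [htens]. *)
Lemma sum_triangle (A : nmodType) (G : nat -> nat -> A) n :
  \sum_(i < n.+1) \sum_(j < i.+1) G i j =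
  \sum_(j < n.+1) \sum_(i < (n - j).+1) G (i + j)%N j.
Proof.
elim: n => [|n IH]; first by rewrite !big_ord1.
rewrite big_ord_recr/= IH [X in _ + X]big_ord_recr/= addrA.
rewrite [RHS]big_ord_recr/= subnn big_ord1/= add0n; congr (_ + _).
rewrite -big_split/=; apply: eq_bigr => j _.
have jn : (j <= n)%N by rewrite -ltnS.
by rewrite subSn// [RHS]big_ord_recr/= -subSn// subnK// ltnW.
Qed.

End FiniteSupport.

(** * K[[h]]-linear maps between topologically free modules *)

Section HLinear.
Context {K : fieldType}.
Implicit Types A B C D : lmodType K.

Lemma hext_hlinear A B (phi : nat -> A -> B) :
  (forall k, linear (phi k)) -> hlinear (hext phi).
Proof.
move=> lphi p s t; apply/funext => n; rewrite !fctE /hscale /hext.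
pose G i j := p j *: phi (n - i)%N (s (i - j)%N).
transitivity (\sum_(i < n.+1) (\sum_(j < i.+1) G i j + phi (n - i)%N (t i))).
  apply: eq_bigr => i _; rewrite -[X in phi _ (X + _)]scale1r lphi scale1r.
  rewrite lin_sum//; congr (_ + _); apply: eq_bigr => j _.
  by rewrite linZ.
rewrite big_split/= sum_triangle; congr (_ + _); apply: eq_bigr => j _.
rewrite scaler_sumr; apply: eq_bigr => i _.
by rewrite /G addnK addnC subnDA.
Qed.

Lemma hscale_hconst A (k : K) (s : {fps A}) :
  hscale (hconst (k : K^o)) s = k *: s.
Proof.
apply/funext => n; rewrite /hscale big_ord_recl/= subn0 big1 ?addr0//.
by move=> i _; rewrite scale0r.
Qed.

Lemma hconst_linear A : linear (@hconst K A).
Proof.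
by move=> k u v; apply/funext => -[|n]; rewrite !fctE//= scaler0 addr0.
Qed.

Lemma hlinear_linear A B (F : {fps A} -> {fps B}) : hlinear F -> linear F.
Proof. by move=> lF k u v; rewrite -!hscale_hconst lF. Qed.

Lemma hlinear_coef A B (F : {fps A} -> {fps B}) k :
  hlinear F -> linear (fun a => F (hconst a) k).
Proof.
move=> /hlinear_linear lF c u v.
by rewrite hconst_linear lF !fctE.
Qed.

(** Write s = h s' + s_0 with s_0 constant. Then F(s) = h F(s') + F(s_0), so the coefficient of
    h^(n+1) in F(s) is that of h^n in F(s') plus a contribution of s_0, and induction on n
    applies. *)
Lemma hlinearE A B (F : {fps A} -> {fps B}) : hlinear F ->
  F = hext (fun k a => F (hconst a) k).
Proof.
move=> lF; pose h : {fps K} := fun n => (n == 1)%:R.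
have hS C (s : {fps C}) n : hscale h s n = if n is n'.+1 then s n' else 0.
  case: n => [|n]; rewrite /hscale /h big_ord_recl/= scale0r add0r.
    by rewrite big_ord0.
  rewrite big_ord_recl/= scale1r subSS subn0 big1 ?addr0// => i _.
  by rewrite scale0r.
suff Fn n s : F s n = hext (fun k a => F (hconst a) k) s n.
  by apply/funext => s; apply/funext => n.
have sE s' : s' = hscale h (fun k => s' k.+1) + hconst (s' 0%N) :> {fps A}.
  by apply/funext => -[|k]; rewrite !fctE hS /= ?add0r ?addr0.
elim: n s => [|n IH] s; rewrite {1}(sE s) lF !fctE hS /hext big_ord_recl/=.
  by rewrite add0r big_ord0 addr0.
by rewrite IH /hext subn0 addrC.
Qed.

(* [K[[h]]]-linearity alone forces [h]-adic continuity. *)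
Lemma hlinear_trunc A B (F : {fps A} -> {fps B}) (s t : {fps A}) M :
  hlinear F -> (forall k, (k < M)%N -> s k = t k) ->
  forall k, (k < M)%N -> F s k = F t k.
Proof.
move=> lF st k kM; rewrite (hlinearE lF) /hext; apply: eq_bigr => i _.
by rewrite st//; apply: leq_ltn_trans kM; rewrite -ltnS.
Qed.

Lemma hlinear_comp A B C (F : {fps B} -> {fps C}) (G : {fps A} -> {fps B}) :
  hlinear F -> hlinear G -> hlinear (F \o G).
Proof. by move=> lF lG p s t /=; rewrite lG lF. Qed.

Lemma hmap_hlinear A B (phi : A -> B) : linear phi -> hlinear (hmap phi).
Proof.
move=> lphi p s t; apply/funext => n; rewrite !fctE /hmap /hscale.
rewrite -[X in phi (X + _)]scale1r lphi scale1r lin_sum//; congr (_ + _).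
by apply: eq_bigr => i _; rewrite linZ.
Qed.

Lemma hscale_hlinear A (p : {fps K}) : hlinear (@hscale K A p).
Proof.
have -> : @hscale K A p = hext (fun k a => p k *: a).
  apply/funext => s; apply/funext => n; rewrite /hscale /hext.
  rewrite (reindex_inj rev_ord_inj)/=; apply: eq_bigr => i _.
  by rewrite subSS subKn// -ltnS.
by apply: hext_hlinear => k c u v; rewrite scalerDr !scalerA mulrC.
Qed.

Lemma htensr_hlinear A B C (F : {fps A} -> {fps B}) :
  hlinear F -> hlinear (htensr (C := C) F).
Proof.
move=> lF; apply: hext_hlinear => k; apply: tmap_linear => //.
exact: hlinear_coef.
Qed.

Lemma htensl_hlinear A B C (F : {fps A} -> {fps B}) :
  hlinear F -> hlinear (htensl (C := C) F).
Proof.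
move=> lF; apply: hext_hlinear => k; apply: tmap_linear => //.
exact: hlinear_coef.
Qed.

Lemma hext_hconst A B (phi : nat -> A -> B) a : (forall k, linear (phi k)) ->
  hext phi (hconst a) = phi^~ a.
Proof.
move=> lphi; apply/funext => n; rewrite /hext big_ord_recl/= subn0.
by rewrite big1 ?addr0// => i _; rewrite lin0.
Qed.

Lemma htensr_hconst A B C (F : {fps A} -> {fps B}) (u : A ⊗ C) : hlinear F ->
  htensr F (hconst u) = fun k => tmap (fun a => F (hconst a) k) id u.
Proof.
move=> lF; rewrite /htensr hext_hconst// => k.
by apply: tmap_linear => //; apply: hlinear_coef.
Qed.

Lemma htensr_hconst_tpure A B C (F : {fps A} -> {fps B}) (a : A) (c : C) :
  hlinear F -> htensr F (hconst (a ⊗ c)) = hmap (fun b => b ⊗ c) (F (hconst a)).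
Proof.
move=> lF; rewrite htensr_hconst//; apply/funext => k.
by rewrite tmapE//; apply: hlinear_coef.
Qed.

Lemma hlinear_ext A B (F G : {fps A} -> {fps B}) : hlinear F -> hlinear G ->
  (forall a, F (hconst a) = G (hconst a)) -> F = G.
Proof.
move=> lF lG FG; rewrite (hlinearE lF) (hlinearE lG); congr hext.
by apply/funext => k; apply/funext => a; rewrite FG.
Qed.

(** Constants suffice by [hlinearE]; among them pure tensors suffice, because each h-coefficient of
    [F (hconst t)] is linear in [t]. *)
Lemma hlinear_tens_ext A B C (F G : {fps A ⊗ B} -> {fps C}) :
  hlinear F -> hlinear G ->
  (forall a b, F (hconst (a ⊗ b)) = G (hconst (a ⊗ b))) -> F = G.
Proof.
move=> lF lG FG; apply: hlinear_ext => // t; apply/funext => k.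
suff : (fun t => F (hconst t) k) = (fun t => G (hconst t) k).
  by move/(congr1 (@^~ t)).
by apply: tens_ext => [||a b]; rewrite ?FG//; apply: hlinear_coef.
Qed.

(** Both sides sum F(s_j)_k ⊗ c_l over j + k + l = n. After [sum_triangle] isolates j, reversing the
    inner sum exchanges the roles of k and l. *)
Lemma htensr_htens A B C (F : {fps A} -> {fps B}) (s : {fps A}) (c : {fps C}) :
  hlinear F -> htensr F (htens s c) = htens (F s) c.
Proof.
move=> lF; apply/funext => n; rewrite [in RHS](hlinearE lF).
rewrite /htensr /htens /hext.
pose G i j := F (hconst (s j)) (n - i)%N ⊗ c (i - j)%N.
pose H i j := F (hconst (s j)) (i - j)%N ⊗ c (n - i)%N.
transitivity (\sum_(i < n.+1) \sum_(j < i.+1) G i j).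
  apply: eq_bigr => i _; rewrite lin_sum; last first.
    by apply: tmap_linear => //; apply: hlinear_coef.
  by apply: eq_bigr => j _; rewrite tmapE//; apply: hlinear_coef.
transitivity (\sum_(i < n.+1) \sum_(j < i.+1) H i j); last first.
  apply: eq_bigr => i _; rewrite (lin_sum _ _ _ (tpure_linearl _)).
  exact: eq_bigr.
rewrite !sum_triangle; apply: eq_bigr => j _.
rewrite (reindex_inj rev_ord_inj)/=; apply: eq_bigr => i _.
rewrite /G /H !addnK subSS; congr (F _ _ ⊗ c _).
  rewrite addnC subnDA subKn// -ltnS//.
by rewrite addnC subnDA.
Qed.

Lemma htensr_hmap_tmap A B C D (F : {fps A} -> {fps B}) (g : C -> D)
    (s : {fps A ⊗ C}) : hlinear F -> linear g ->
  htensr F (hmap (tmap id g) s) = hmap (tmap id g) (htensr F s).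
Proof.
move=> lF lg; have lt (E : lmodType K) : linear (tmap (@id E) g).
  exact: tmap_linear.
suff : htensr F \o hmap (tmap id g) = hmap (tmap id g) \o htensr F.
  by move/(congr1 (@^~ s)).
apply: hlinear_tens_ext => [||a c].
- exact: hlinear_comp (htensr_hlinear lF) (hmap_hlinear (lt _)).
- exact: hlinear_comp (hmap_hlinear (lt _)) (htensr_hlinear lF).
have hc : hmap (tmap id g) (hconst (a ⊗ c)) = hconst (a ⊗ g c) :> {fps A ⊗ D}.
  by apply/funext => -[|n]; rewrite /hmap/=; [rewrite tmapE | rewrite (lin0 (lt A))].
rewrite /= hc !htensr_hconst_tpure//; apply/funext => n.
by rewrite /hmap tmapE.
Qed.

End HLinear.

(** * Multiplication by f on A_h((z)) *)

Section LaurentDistributions.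
Context {K : fieldType}.
Implicit Types A B C : lmodType K.
Local Notation L := (laurent K).

(* The coefficient of z^p in f(z) y(z), for y in A_h((z)). *)
Definition fmul A (f : {fps L}) (y : int -> {fps A}) (p : int) : {fps A} :=
  fun n => \sum_(i < n.+1)
    \sum_(m \in [set: int]) (f i m *: y (p - m) (n - i)%N).

Lemma fps_laurent_lbound (f : {fps L}) M :
  exists a : int, forall i, (i < M)%N -> forall m, m < a -> f i m = 0.
Proof.
by apply: (@uniform_lbound M (fun i m => f i m = 0)) => i; apply: laurentP.
Qed.

(** Below [a] the factor f vanishes modulo h^M, and for m >= a + d the index p - m lies below [b],
    where y vanishes. What remains is a finite combination of coefficients of y over K[[h]], to
    which K[[h]]-linear maps apply. *)
Lemma fmul_trunc A (f : {fps L}) (y : int -> {fps A}) p (a b : int)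
    (d M : nat) :
  (forall i, (i < M)%N -> forall m, m < a -> f i m = 0) ->
  (forall n, n < b -> forall k, (k < M)%N -> y n k = 0) ->
  p < a + b + d%:Z -> forall k, (k < M)%N ->
  fmul f y p k =
    (\sum_(j < d) hscale (fun i => f i (a + j%:Z)) (y (p - (a + j%:Z)))) k.
Proof.
move=> fa yb pd k kM; rewrite fct_sumE /fmul /hscale exchange_big/=.
apply: eq_bigr => i _.
have ik : (i <= k)%N by rewrite -ltnS.
apply: fsbigZ_range => m hm; first by rewrite fa ?scale0r// (leq_ltn_trans ik).
rewrite yb ?scaler0 ?(leq_ltn_trans (leq_subr _ _))//.
rewrite ltrBlDr (lt_le_trans pd)// [b + m]addrC addrAC.
by rewrite lerD2r.
Qed.

Lemma ltz_natP (x : int) : exists d : nat, x < d%:Z.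
Proof. by exists (`|x|.+1)%N; rewrite -addn1 PoszD ltzD1 lez_abs. Qed.

Lemma fmul_truncP A (f : {fps L}) (y : int -> {fps A}) P M : hlaurent y ->
  exists (a b : int) (d : nat),
  [/\ forall i, (i < M)%N -> forall m, m < a -> f i m = 0,
      forall n, n < b -> forall k, (k < M)%N -> y n k = 0 & P < a + b + d%:Z].
Proof.
move=> hy; have [a fa] := fps_laurent_lbound f M; have [b yb] := hy M.
have [d Pd] := ltz_natP (P - (a + b)).
by exists a, b, d; split=> //; rewrite -ltrBlDl.
Qed.

Lemma hlinear_fmul A B (G : {fps A} -> {fps B}) (f : {fps L})
    (y : int -> {fps A}) p : hlinear G -> hlaurent y ->
  G (fmul f y p) = fmul f (fun n => G (y n)) p.
Proof.
move=> lG hy; apply/funext => k.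
have [a [b [d [fa yb pd]]]] := fmul_truncP f p k.+1 hy.
rewrite (hlinear_trunc lG (fmul_trunc fa yb pd))//.
(* The bound [b] also serves for the image of y, because [G] preserves vanishing modulo h^(k+1). *)
rewrite (fmul_trunc fa _ pd)//; last first.
  move=> n nb i ik; rewrite (hlinear_trunc (t := 0) lG _ ik).
    by rewrite (lin0 (hlinear_linear lG)).
  by move=> j jk; rewrite yb.
rewrite (lin_sum _ _ _ (hlinear_linear lG)) !fct_sumE; apply: eq_bigr => j _.
have lG0 p' s : G (hscale p' s) = hscale p' (G s).
  by rewrite -[hscale p' s]addr0 lG (lin0 (hlinear_linear lG)) addr0.
exact: (congr1 (@^~ k) (lG0 _ _)).
Qed.

Lemma fmul_hlinear A B (f : {fps L}) (Y : {fps A} -> int -> {fps B}) p :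
  (forall n, hlinear (Y^~ n)) -> (forall t, hlaurent (Y t)) ->
  hlinear (fun t => fmul f (Y t) p).
Proof.
move=> lY hY q s t; apply/funext => k.
have [a fa] := fps_laurent_lbound f k.+1.
have [b1 yb1] := hY s k.+1; have [b2 yb2] := hY t k.+1.
have [b3 yb3] := hY (hscale q s + t) k.+1.
(* A common pole bound lets the same [d] terms compute all three products. *)
pose b := Num.min b1 (Num.min b2 b3).
have [d] := ltz_natP (p - (a + b)); rewrite ltrBlDl => pd.
have bnd i : i < b -> [/\ i < b1, i < b2 & i < b3].
  by rewrite !lt_min => /andP[-> /andP[-> ->]].
have y1 i : i < b -> forall j, (j < k.+1)%N -> Y s i j = 0.
  by move=> /bnd[i1 _ _]; apply: yb1.
have y2 i : i < b -> forall j, (j < k.+1)%N -> Y t i j = 0.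
  by move=> /bnd[_ i2 _]; apply: yb2.
have y3 i : i < b -> forall j, (j < k.+1)%N -> Y (hscale q s + t) i j = 0.
  by move=> /bnd[_ _ i3]; apply: yb3.
rewrite (fmul_trunc fa y3 pd)//.
rewrite -[RHS]/(hscale q (fmul f (Y s) p) k + fmul f (Y t) p k).
rewrite (fmul_trunc fa y2 pd)//.
rewrite (hlinear_trunc (hscale_hlinear q) (fmul_trunc fa y1 pd))//.
have lq := hlinear_linear (@hscale_hlinear K B q).
rewrite (lin_sum _ _ _ lq) !fct_sumE -big_split/=; apply: eq_bigr => j _.
rewrite lY (linD _ _ (hlinear_linear (hscale_hlinear _))) !fctE.
congr (_ + _).
have lG0 p' : hscale p' (hscale q (Y s (p - (a + j%:Z)))) =
   hscale q (hscale p' (Y s (p - (a + j%:Z)))).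
  have := @hscale_hlinear K B p' q (Y s (p - (a + j%:Z))) 0.
  by rewrite (lin0 (hlinear_linear (hscale_hlinear _))) !addr0.
exact: (congr1 (@^~ k) (lG0 _)).
Qed.

(** Modulo h^M only the first M coefficients of [s] matter. Each is a finite sum of pure tensors a ⊗
    c, for which the pole bound of Y(a) works, so a minimum of finitely many bounds suffices. *)
Lemma htensr_hlaurent A B C (Y : {fps A} -> int -> {fps B}) :
  (forall n, hlinear (Y^~ n)) -> (forall t, hlaurent (Y t)) ->
  forall s : {fps A ⊗ C}, hlaurent (fun n => htensr (Y^~ n) s).
Proof.
move=> lY hY s M.
have lt n k := tmap_linear (hlinear_coef k (lY n)) (@lin_id _ C).
have tb (t : A ⊗ C) : exists N : int, forall n, n < N -> forall k, (k < M)%N ->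
    tmap (fun a => Y (hconst a) n k) id t = 0.
  move: t; apply: tens_ind => [|s' t [N1 h1] [N2 h2]|a c].
  - by exists 0 => n _ k _; rewrite (lin0 (lt n k)).
  - exists (Num.min N1 N2) => n; rewrite lt_min => /andP[n1 n2] k kM.
    by rewrite (linD _ _ (lt n k)) h1// h2// addr0.
  have [N hN] := hY (hconst a) M; exists N => n nN k kM.
  rewrite tmapE//; last exact: (hlinear_coef k (lY n)).
  by rewrite hN// (lin0 (tpure_linearl c)).
have [N hN] := uniform_lbound M (fun i => tb (s i)).
exists N => n nN k kM; rewrite /htensr /hext big1// => i _.
have ik : (i <= k)%N by rewrite -ltnS.
by rewrite (hN i) ?(leq_ltn_trans ik)// (leq_ltn_trans (leq_subr _ _)).
Qed.

Lemma htensr_fmul A B C (f : {fps L}) (Y : {fps A} -> int -> {fps B}) p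
    (s : {fps A ⊗ C}) :
  (forall n, hlinear (Y^~ n)) -> (forall t, hlaurent (Y t)) ->
  htensr (fun t => fmul f (Y t) p) s = fmul f (fun n => htensr (Y^~ n) s) p.
Proof.
move=> lY hY; have lf := fmul_hlinear f p lY hY.
suff : htensr (fun t => fmul f (Y t) p) =
    (fun s : {fps A ⊗ C} => fmul f (fun n => htensr (Y^~ n) s) p).
  by move/(congr1 (@^~ s)).
apply: hlinear_tens_ext => [||a c].
- exact: htensr_hlinear.
- apply: fmul_hlinear => [n|]; first exact: htensr_hlinear.
  exact: htensr_hlaurent.
rewrite htensr_hconst_tpure//.
rewrite (hlinear_fmul _ _ (hmap_hlinear (tpure_linearl c)))//.
by congr fmul; apply/funext => n; rewrite htensr_hconst_tpure.
Qed.

(* The convergence of the sum over l is uniform in p because f and y have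
   poles of bounded order modulo each power of h. *)
Lemma fmul_hsum A B (e : nat -> A -> B) (f : {fps L}) (y : int -> {fps A})
    (x : int -> {fps B}) : (forall l, linear (e l)) -> hlaurent y ->
  (forall n, hsum (fun l => hmap (e l) (y (n - l%:Z))) (x n)) ->
  forall P M, exists N : nat, forall n, (N <= n)%N -> forall p, p <= P ->
  forall k, (k < M)%N ->
  \sum_(l < n) hmap (e l) (fmul f y (p - l%:Z)) k = fmul f x p k.
Proof.
move=> le hy hx P M; have [a [b [d [fa yb Pd]]]] := fmul_truncP f P M hy.
have e0 q l k : q - l%:Z < b -> (k < M)%N -> e l (y (q - l%:Z) k) = 0.
  by move=> ql kM; rewrite yb// lin0.
(* For q < b + d the terms with l >= d have q - l < b and vanish, so [d] terms already give the
   limit. *)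
have xE q n k : q < b + d%:Z -> (d <= n)%N -> (k < M)%N ->
    \sum_(l < n) e l (y (q - l%:Z) k) = x q k.
  move=> qd dn kM; have [N hN] := hx q M.
  rewrite -(hN (maxn n N))// ?leq_maxr// -(subnKC (leq_maxl n N)).
  rewrite big_split_ord/=.
  rewrite [X in _ + X]big1 ?addr0// => i _; apply: e0 => //.
  rewrite ltrBlDr (lt_le_trans qd)// lerD2l lez_nat (leq_trans dn)// leq_addr//.
(* Below [b] every term of the series for x vanishes, so x inherits the pole bound of y. *)
have xb n : n < b -> forall k, (k < M)%N -> x n k = 0.
  move=> nb k kM; rewrite -(xE _ d)//; last by rewrite (lt_le_trans nb)// lerDl.
  by rewrite big1// => l _; apply: e0 => //; rewrite (le_lt_trans _ nb)// gerBl.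
(* For p <= P the indices q = p - (a + j) that occur satisfy q < b + d, so [d] serves for all p at
   once. *)
exists d => n dn p pP k kM; have pd := le_lt_trans pP Pd.
have pl (l : nat) : p - l%:Z < a + b + d%:Z.
  by rewrite (le_lt_trans _ pd)// gerBl.
rewrite (fmul_trunc fa xb pd)// fct_sumE.
under eq_bigr => l _.
  rewrite /hmap (fmul_trunc fa yb (pl l) kM).
  rewrite fct_sumE (lin_sum _ _ _ (le l)).
  over.
rewrite exchange_big/=; apply: eq_bigr => j _; rewrite /hscale.
under eq_bigr => l _ do rewrite (lin_sum _ _ _ (le l)).
rewrite exchange_big/=; apply: eq_bigr => i _.
rewrite -(xE _ n) ?(leq_ltn_trans (leq_subr _ _))//; last first.
  by rewrite ltrBlDr (lt_le_trans pd)// addrA [b + _ + a]addrC addrA lerDl.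
rewrite scaler_sumr; apply: eq_bigr => l _.
by rewrite (linZ _ _ (le l)) addrAC.
Qed.

End LaurentDistributions.

(** * Operations on the Laurent factors: product, derivative, expansion, diagonal *)

Section LaurentFactors.
Context {K : fieldType}.
Implicit Types A B C : lmodType K.
Local Notation L := (laurent K).

Lemma laurent_linP (k : K) (g g' : L) (n : int) :
  (k *: g + g') n = k * g n + g' n.
Proof. by []. Qed.

Lemma laurent_eq (g g' : L) : (forall n : int, g n = g' n) -> g = g'.
Proof. by move=> gg'; apply: val_inj; apply/funext. Qed.

Lemma lmul_range (g g' : L) (a b : int) (d : nat) (n : int) :
  (forall m, m < a -> g m = 0) -> (forall m, m < b -> g' m = 0) ->
  n < a + b + d%:Z ->
  lmul g g' n = \sum_(j < d) g (a + j%:Z) * g' (n - (a + j%:Z)).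
Proof.
move=> ga g'b nd; apply: fsbigZ_range => m hm; first by rewrite ga// mul0r.
rewrite g'b ?mulr0// ltrBlDr (lt_le_trans nd)// [b + m]addrC addrAC.
by rewrite lerD2r.
Qed.

Lemma lmul_bilinear : bilinear_for *:%R *:%R (@lmul K).
Proof.
split=> [g'|g'] k g1 g2; apply: laurent_eq => n;
  have [b g'b] := laurentP g'; have [a1 g1a] := laurentP g1;
  have [a2 g2a] := laurentP g2; pose a := Num.min a1 a2;
  have h1 m : m < a -> g1 m = 0 by [rewrite lt_min => /andP[/g1a]];
  have h2 m : m < a -> g2 m = 0 by [rewrite lt_min => /andP[_ /g2a]];
  have h3 m : m < a -> (k *: g1 + g2) m = 0
    by [move=> ma; rewrite laurent_linP h1// h2// mulr0 addr0];
  have [d] := ltz_natP (n - (a + b)); rewrite ltrBlDl => nd.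
- rewrite laurent_linP !(lmul_range (a := a) (b := b) (d := d))//.
  rewrite mulr_sumr -big_split/=; apply: eq_bigr => j _.
  transitivity ((k * g1 (a + j%:Z) + g2 (a + j%:Z)) * g' (n - (a + j%:Z))) => //.
  by rewrite mulrDl mulrA.
- rewrite [a + b]addrC in nd.
  rewrite laurent_linP !(lmul_range (a := b) (b := a) (d := d))//.
  rewrite mulr_sumr -big_split/=; apply: eq_bigr => j _.
  set m := n - _.
  transitivity (g' (b + j%:Z) * (k * g1 m + g2 m)) => //.
  by rewrite mulrDr mulrCA.
Qed.

Lemma liota_linear l : linear (@liota K l).
Proof.
by move=> k g g'; apply: laurent_eq => n; rewrite laurent_linP /= mulrDr mulrCA.
Qed.

Lemma lderiv_linear : linear (@lderiv K).
Proof.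
by move=> k g g'; apply: laurent_eq => n; rewrite laurent_linP /= mulrDr mulrCA.
Qed.

Lemma iter_lderivE l (g : L) (n : int) :
  iter l lderiv g n = (\prod_(i < l) (n + l%:Z - i%:Z)%:~R) * g (n + l%:Z).
Proof.
elim: l n => [|l IH] n; first by rewrite big_ord0 mul1r addr0.
rewrite /= IH big_ord_recr/= mulrCA -addrA -intS mulrA; congr (_ * _ * _).
by rewrite intS addrA addrK.
Qed.

(** Taylor's formula: both sides multiply the coefficient of index n + l by the same falling
    factorial divided by l!. *)
Lemma liota_lderiv l : liota l = (l`!)%:R^-1 \*: iter l (@lderiv K).
Proof.
apply/funext => g; apply: laurent_eq => n; rewrite /=.
rewrite -[RHS]/(_ * _) iter_lderivE /gbinom mulrA; congr (_ * _).
by rewrite mulrC.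
Qed.

Lemma diag_linear A : linear (@diag K A).
Proof.
apply: (lin_comp (f := tmap id (tlift (@lmul K)))); last exact: tassoc_linear.
by apply: tmap_linear => //; apply/tlift_linear/lmul_bilinear.
Qed.

Lemma diagE A (a : A) (g g' : L) : diag (a ⊗ g ⊗ g') = a ⊗ lmul g g'.
Proof.
have lm := lmul_bilinear.
by rewrite /diag tassocE tmapE ?tliftE//; apply: tlift_linear.
Qed.

(** [F] acts on [A] and [diag] on the two Laurent factors, so they commute. The test on pure tensors
    peels off first the outer, then the inner Laurent factor. *)
Lemma htensr_diag A B (F : {fps A} -> {fps B}) (y : {fps A ⊗ L ⊗ L}) :
  hlinear F -> htensr F (hmap diag y) = hmap diag (htensr (htensr F) y).
Proof.
move=> lF; have lF1 := htensr_hlinear (C := L) lF.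
suff : htensr F \o hmap diag = hmap diag \o htensr (htensr F).
  by move/(congr1 (@^~ y)).
apply: hlinear_ext => [||u].
- exact: hlinear_comp (htensr_hlinear lF) (hmap_hlinear (@diag_linear A)).
- exact: hlinear_comp (hmap_hlinear (@diag_linear B)) (htensr_hlinear lF1).
have hc : hmap diag (hconst u) = hconst (diag u).
  by apply/funext => -[|n]//=; rewrite /hmap (lin0 (@diag_linear A)).
rewrite /= hc !htensr_hconst//; apply/funext => k.
have lt := hlinear_coef k lF; have lt1 := hlinear_coef k lF1.
suff : tmap (fun a => F (hconst a) k) id \o diag =
    diag \o tmap (fun a => htensr F (hconst a) k) id.
  by move/(congr1 (@^~ u)).
apply: tens_ext => [||ag g'].
- by apply: lin_comp; [apply: tmap_linear | apply: diag_linear].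
- by apply: lin_comp; [apply: diag_linear | apply: tmap_linear].
suff : (fun ag => tmap (fun a => F (hconst a) k) id (diag (ag ⊗ g'))) =
   (fun ag => diag (tmap (fun a => htensr F (hconst a) k) id (ag ⊗ g'))).
  by move/(congr1 (@^~ ag)).
have lp := @tpure_linearl K (A ⊗ L)%type L g'.
apply: tens_ext => [||a g].
- apply: (lin_comp (f := tmap _ _ \o diag)) lp.
  by apply: lin_comp; [apply: tmap_linear | apply: diag_linear].
- apply: (lin_comp (f := diag \o tmap _ _)) lp.
  by apply: lin_comp; [apply: diag_linear | apply: tmap_linear].
by rewrite diagE !tmapE// htensr_hconst// tmapE// diagE.
Qed.

End LaurentFactors.

(** * Coefficients in lambda and h-adic convergence *)

Section PolynomialCoefficients.
Context {K : fieldType}.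
Implicit Types A B C : lmodType K.

(* The coefficient of lambda^j / j!; the normalization turns d/dlambda into the
   shift of j. *)
Definition dpcoef A (j : nat) : A ⊗ {poly K} -> A :=
  tlift (fun (a : A) (P : {poly K}) => ((j`!)%:R * P`_j) *: a).

Lemma dpcoef_bilinear A j :
  bilinear_for *:%R *:%R (fun (a : A) (P : {poly K}) => ((j`!)%:R * P`_j) *: a).
Proof.
split=> [P|a] k u v /=; first by rewrite scalerDr !scalerA mulrC.
by rewrite coefD coefZ mulrDr mulrCA scalerDl scalerA.
Qed.

Lemma dpcoef_linear A j : linear (@dpcoef A j).
Proof. exact/tlift_linear/dpcoef_bilinear. Qed.

Lemma dpcoefE A j (a : A) (P : {poly K}) :
  dpcoef j (a ⊗ P) = ((j`!)%:R * P`_j) *: a.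
Proof. by rewrite /dpcoef tliftE//; apply: dpcoef_bilinear. Qed.

Lemma deriv_linear : linear (@deriv K).
Proof. by move=> k p q; rewrite derivD derivZ. Qed.

Lemma dlambda_linear A : linear (@dlambda K A).
Proof. by apply: tmap_linear => //; apply: deriv_linear. Qed.

Lemma dpcoef_dlambda A j (u : A ⊗ {poly K}) :
  dpcoef j (dlambda u) = dpcoef j.+1 u.
Proof.
suff : dpcoef (A := A) j \o dlambda = dpcoef j.+1 by move/(congr1 (@^~ u)).
apply: tens_ext => [||a P].
- exact: lin_comp (@dpcoef_linear A j) (@dlambda_linear A).
- exact: dpcoef_linear.
rewrite /= /dlambda tmapE//; last exact: deriv_linear.
by rewrite !dpcoefE coef_deriv factS mulnC natrM -[P`__ *+ _]mulr_natl mulrA.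
Qed.

Lemma dpcoef_iter_dlambda A j l (u : A ⊗ {poly K}) :
  dpcoef j (iter l dlambda u) = dpcoef (j + l) u.
Proof.
by elim: l j => [|l IH] j; rewrite ?addn0//= dpcoef_dlambda IH addSnnS.
Qed.

Lemma dpcoef_tmap A B (phi : A -> B) j (u : A ⊗ {poly K}) : linear phi ->
  dpcoef j (tmap phi id u) = phi (dpcoef j u).
Proof.
move=> lphi.
suff : dpcoef j \o tmap phi id = phi \o dpcoef j by move/(congr1 (@^~ u)).
apply: tens_ext => [||a P].
- by apply: lin_comp; [apply: dpcoef_linear | apply: tmap_linear].
- by apply: lin_comp => //; apply: dpcoef_linear.
by rewrite /= tmapE// !dpcoefE linZ.
Qed.

Lemma dpcoef_tAC A C j (u : A ⊗ {poly K} ⊗ C) :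
  dpcoef j (tAC u) = tmap (dpcoef j) id u.
Proof.
have lj B := @dpcoef_linear B j; have ltAC := @tAC_linear K A {poly K} C.
suff : dpcoef j \o @tAC K A {poly K} C = tmap (@dpcoef A j) id.
  by move/(congr1 (@^~ u)).
apply: tens_ext => [||ap c].
- exact: lin_comp (lj _) ltAC.
- exact: tmap_linear (lj A) (@lin_id K C).
suff : (fun ap => dpcoef j (tAC (ap ⊗ c))) =
    (fun ap : A ⊗ {poly K} => tmap (dpcoef j) id (ap ⊗ c)).
  by move/(congr1 (@^~ ap)).
have lp := @tpure_linearl K (A ⊗ {poly K})%type C c.
apply: tens_ext => [||a P].
- exact: lin_comp (lin_comp (lj _) ltAC) lp.
- exact: lin_comp (tmap_linear (lj A) (@lin_id K C)) lp.
rewrite tACE (tmapE _ _ (lj A) (@lin_id K C)).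
by rewrite (dpcoefE j (a ⊗ c) P) (dpcoefE j a P) tpureZl.
Qed.

Lemma dpcoef_eventually0 A (u : A ⊗ {poly K}) :
  exists N, forall j, (N <= j)%N -> dpcoef j u = 0.
Proof.
move: u; apply: tens_ind => [|u v [N1 h1] [N2 h2]|a P].
- by exists 0%N => j _; rewrite (lin0 (@dpcoef_linear A j)).
- exists (maxn N1 N2) => j; rewrite geq_max => /andP[n1 n2].
  by rewrite (linD _ _ (@dpcoef_linear A j)) h1// h2// addr0.
- exists (size P) => j jP; rewrite dpcoefE nth_default// mulr0 scale0r//.
Qed.

(** In characteristic zero j! is invertible, so every tensor is the finite sum of its coefficients
    times lambda^j / j!. This reduces identities in lambda to identities of coefficients. *)
Lemma dpcoef_inj A (u v : A ⊗ {poly K}) : [pchar K] =i pred0 ->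
  (forall j, dpcoef j u = dpcoef j v) -> u = v.
Proof.
move=> charK uv.
have sumE (w : A ⊗ {poly K}) : exists N, forall n, (N <= n)%N ->
    w = \sum_(i < n) dpcoef i w ⊗ ((i`!)%:R^-1 *: 'X^i).
  move: w; apply: tens_ind => [|w w' [N1 h1] [N2 h2]|a P].
  - exists 0%N => n _; rewrite big1// => i _.
    by rewrite (lin0 (@dpcoef_linear A i)) (lin0 (tpure_linearl _)).
  - exists (maxn N1 N2) => n; rewrite geq_max => /andP[/h1 h1' /h2 h2'].
    rewrite {1}h1' {1}h2' -big_split/=; apply: eq_bigr => i _.
    by rewrite (linD _ _ (@dpcoef_linear A i)) tpureDl.
  exists (size P) => n Pn.
  have PE : P = \sum_(i < n) P`_i *: 'X^i :> {poly K}.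
    rewrite -[LHS]coefK poly_def -(subnKC Pn) big_split_ord/=.
    rewrite [X in _ = _ + X]big1 ?addr0// => i _.
    by rewrite nth_default ?leq_addr// scale0r.
  rewrite {1}PE (lin_sum _ _ _ (tpure_linearr a)); apply: eq_bigr => i _.
  rewrite (dpcoefE i a P) (linZ _ _ (tpure_linearr _)) tpureZl.
  rewrite (linZ _ _ (tpure_linearr _)) scalerA mulrAC mulfV ?mul1r//.
  by have [h _] := pcharf0P K; rewrite (h charK) -lt0n fact_gt0.
have [N1 h1] := sumE u; have [N2 h2] := sumE v.
rewrite (h1 (maxn N1 N2)) ?leq_maxl// (h2 (maxn N1 N2)) ?leq_maxr//.
by apply: eq_bigr => i _; rewrite uv.
Qed.

Lemma hmap_htensr A B C D (F : {fps A} -> {fps B}) (g : B -> C)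
    (t : {fps A ⊗ D}) : hlinear F -> linear g ->
  hmap (tmap g id) (htensr F t) = htensr (hmap g \o F) t.
Proof.
move=> lF lg; have lgF := hlinear_comp (hmap_hlinear lg) lF.
have lt : linear (tmap g (@id D)) by apply: tmap_linear.
suff : hmap (tmap g id) \o htensr F = htensr (C := D) (hmap g \o F).
  by move/(congr1 (@^~ t)).
apply: hlinear_tens_ext => [||a d].
- exact: hlinear_comp (hmap_hlinear lt) (htensr_hlinear lF).
- exact: htensr_hlinear.
rewrite /= !htensr_hconst_tpure//; apply/funext => k.
by rewrite /hmap tmapE.
Qed.

Lemma lext_hlinear A B C (F : {fps A} -> {fps B ⊗ {poly K}}) :
  hlinear F -> hlinear (lext (C := C) F).
Proof.
move=> lF; exact: hlinear_comp (hmap_hlinear (@tAC_linear K B {poly K} C))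
  (htensr_hlinear lF).
Qed.

Lemma dpcoef_lext A B C (F : {fps A} -> {fps B ⊗ {poly K}}) j
    (t : {fps A ⊗ C}) : hlinear F ->
  hmap (dpcoef j) (lext F t) = htensr (hmap (dpcoef j) \o F) t.
Proof.
move=> lF; rewrite -hmap_htensr//; last exact: dpcoef_linear.
by apply/funext => k; rewrite /hmap dpcoef_tAC.
Qed.

Lemma dpcoef_htensr A B (F : {fps A} -> {fps B}) j (t : {fps A ⊗ {poly K}}) :
  hlinear F -> hmap (dpcoef j) (htensr F t) = F (hmap (dpcoef j) t).
Proof.
move=> lF; rewrite [in RHS](hlinearE lF); apply/funext => k.
rewrite /hmap /htensr /hext (lin_sum _ _ _ (@dpcoef_linear B j)).
apply: eq_bigr => i _; rewrite dpcoef_tmap//; exact: hlinear_coef.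
Qed.

Lemma dpcoef_htens A C j (s : {fps A ⊗ {poly K}}) (c : {fps C}) :
  hmap (dpcoef j) (hmap tAC (htens s c)) = htens (hmap (dpcoef j) s) c.
Proof.
apply/funext => k; rewrite /hmap dpcoef_tAC /htens lin_sum; last first.
  by apply: tmap_linear => //; apply: dpcoef_linear.
by apply: eq_bigr => i _; rewrite tmapE//; apply: dpcoef_linear.
Qed.

Lemma hsum_exists A (u : nat -> {fps A}) :
  (forall k, exists N, forall l, (N <= l)%N -> u l k = 0) ->
  exists s, hsum u s.
Proof.
move=> /choice[N hN]; exists (fun k => \sum_(l < N k) u l k) => M.
exists (\max_(k < M) N k)%N => n nM k kM.
have kn : (N k <= n)%N.
  by apply: leq_trans nM; rewrite (leq_bigmax (Ordinal kM)).
rewrite -(subnKC kn) big_split_ord/= [X in _ + X]big1 ?addr0// => i _.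
by rewrite hN// leq_addr.
Qed.

End PolynomialCoefficients.

(** * Divided derivatives and the terms of the exponential *)

Section Taylor.
Context {K : fieldType}.
Implicit Types A : lmodType K.
Local Notation L := (laurent K).

Lemma dx_linear A : linear (@dx K A).
Proof. by apply: tmap_linear => //; apply: lderiv_linear. Qed.

Lemma iter_dxE A l : iter l (@dx K A) = tmap id (iter l (@lderiv K)).
Proof.
(* Linearity of the iterate is carried through the induction because [tmap_comp] requires it. *)
suff [] : iter l (@dx K A) = tmap id (iter l (@lderiv K)) /\
  linear (iter l (@lderiv K)) by [].
elim: l => [|l [IH lIH]].
  split=> //; apply: tens_ext => //; first exact: tmap_linear.
  by move=> a g; rewrite tmapE.
have ll : linear (iter l.+1 (@lderiv K)) by exact: lin_comp lderiv_linear lIH.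
split=> //; rewrite -[LHS]/(dx \o iter l dx) IH /dx.
by rewrite (tmap_comp (@lin_id _ _) (@lin_id _ _) lderiv_linear lIH).
Qed.

Lemma iter_dx_linear A l : linear (iter l (@dx K A)).
Proof.
by elim: l => [//|l IH]; apply: (lin_comp (f := @dx K A) (g := iter l dx) _ IH);
  apply: dx_linear.
Qed.

Lemma dx_liota A l (v : A ⊗ L) :
  (l`!)%:R^-1 *: iter l dx v = tmap id (liota l) v.
Proof.
have ll := @liota_linear K l.
have lld : linear (iter l (@lderiv K)).
  elim: (l) => [//|i IH].
  exact: (lin_comp (g := iter i lderiv) lderiv_linear IH).
suff : (fun v => (l`!)%:R^-1 *: iter l (@dx K A) v) = tmap id (liota l).
  by move/(congr1 (@^~ v)).
apply: tens_ext => [||a g].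
- move=> k x y; rewrite iter_dx_linear scalerDr !scalerA; congr (_ *: _ + _).
  exact: mulrC.
- by apply: tmap_linear.
rewrite iter_dxE !tmapE// liota_lderiv.
exact/esym/(linZ _ _ (tpure_linearr a)).
Qed.

(** In the l-th term of the exponential, the power of d_lambda shifts j by l, while the power of d_x
    divided by l! is [liota l]. *)
Lemma dpcoef_iter_exp A j l (v : A ⊗ L ⊗ {poly K}) :
  dpcoef j ((l`!)%:R^-1 *: iter l (fun w => dlambda (tmap dx id w)) v) =
  tmap id (liota l) (dpcoef (j + l) v).
Proof.
rewrite -dx_liota (linZ _ _ (@dpcoef_linear _ _ j)); congr (_ *: _).
elim: l j => [|l IH] j; first by rewrite addn0.
by rewrite /= dpcoef_dlambda dpcoef_tmap ?IH ?addSnnS//; apply: dx_linear.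
Qed.

Lemma iter_hmap A (g : A -> A) l (u : {fps A}) k :
  iter l (hmap g) u k = iter l g (u k).
Proof. by elim: l => //= l <-. Qed.

End Taylor.

(** * Linearity and coefficients of the (lambda,f)-product *)

Section BraidedStateField.
Context {K : fieldType} {W : lmodType K} (V : braided_sfc W).
Implicit Types A B C : lmodType K.
Local Notation L := (laurent K).

Lemma S23_hlinear : hlinear (S23 V).
Proof.
have lS := htensl_hlinear (C := W) (sfS_linear V).
have la := hmap_hlinear (@tassoc_linear K W W W).
apply: (hlinear_comp (F := hmap _)); last exact: hlinear_comp lS la.
apply: hmap_hlinear; apply: (lin_comp (f := tmap tassocV id)).
  by apply: tmap_linear => //; apply: tassocV_linear.
exact: tassocV_linear.
Qed.

Lemma fY_hlinear (f : {fps L}) p : hlinear (fun t => fY V f t p).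
Proof. exact: fmul_hlinear (sfY_linear V) (sfY_laurent V). Qed.

Lemma lprod_dpcoef (f : {fps L}) (t : {fps W ⊗ W}) j : [pchar K] =i pred0 ->
  hmap (dpcoef j) (lprod V f t) = fY V f t (-1 - j%:Z).
Proof.
move=> charK; apply/funext => k.
have [a fa] := fps_laurent_lbound f k.+1.
have [b yb] := sfY_laurent V t k.+1.
have [N pN] := ltz_natP (-1 - (a + b)).
(* [N] is chosen so that -1 - n < a + b, below the poles of f Y; the truncation then has [d = 0]
   terms. *)
have F0 n : (N <= n)%N -> fY V f t (-1 - n%:Z) k = 0.
  move=> Nn; apply: (etrans (fmul_trunc (d := 0) fa yb _ (ltnSn k))).
    by rewrite addr0 ltrBlDl -ltrBlDr (lt_le_trans pN).
  by rewrite big_ord0.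
(* The range is enlarged to contain [j], the only index that contributes; its factor is j! / j! =
   1. *)
rewrite /hmap /lprod (@fsbigT_seq _ _ (iota 0 (maxn N j.+1))) ?iota_uniq//.
  rewrite (lin_sum _ _ _ (@dpcoef_linear K W j)).
  rewrite (bigD1_seq j) ?iota_uniq ?mem_iota/= ?add0n ?leq_maxr//.
  rewrite big1 ?addr0 => [|n nj]; rewrite (dpcoefE _ _ (_ *: _)) coefZ coefXn.
    rewrite eqxx mulr1 mulfV ?scale1r//.
    by have [h _] := pcharf0P K; rewrite (h charK) -lt0n fact_gt0.
  by rewrite eq_sym (negbTE nj) !mulr0 scale0r.
move=> n; rewrite mem_iota/= add0n -leqNgt geq_max => /andP[/F0 -> _].
exact: lin0 (tpure_linearl _).
Qed.

(** The support of the sum over n depends on the argument, so linearity is tested on the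
    coefficients of lambda^j / j!, where it is that of [fY]. *)
Lemma lprod_hlinear (f : {fps L}) : [pchar K] =i pred0 -> hlinear (lprod V f).
Proof.
move=> charK p s t; apply/funext => k; apply: dpcoef_inj => // j.
suff : hmap (dpcoef j) (lprod V f (hscale p s + t)) =
    hmap (dpcoef j) (hscale p (lprod V f s) + lprod V f t).
  by move/(congr1 (@^~ k)).
rewrite (hmap_hlinear (@dpcoef_linear K W j)) !lprod_dpcoef//.
exact: fY_hlinear.
Qed.

End BraidedStateField.

(** * The braiding of a (lambda,f)-product *)

Theorem proposition5 (K : fieldType) (charK : [pchar K] =i pred0)
    (W : lmodType K) (V : braided_sfc W) (hexV : hexagon V)
    (a b c : {fps W}) (f : {fps (laurent K)}) :
  let abc : {fps W ⊗ W ⊗ W} := htens (htens a b) c in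
  (* S(x) (a_(lambda,f) b ⊗ c) *)
  let lhs : {fps W ⊗ W ⊗ laurent K ⊗ {poly K}} :=
    htensr (sfS V) (hmap tAC (htens (lprod V f (htens a b)) c)) in
  hsum (fun l : nat =>
          iter l (hmap dlambda)
            (lext (lext (lprod V f))
               (hmap diag
                  (S23_ext V
                     ((l`!)%:R^-1 *: iter l (hmap dx) (S13 V abc))))))
       lhs
  /\
  exists2 R : {fps W ⊗ W ⊗ laurent K ⊗ laurent K ⊗ {poly K}},
    hexp (fun u => hmap dlambda (hmap (tmap dx id) u))
         (lext (lext (lext (lprod V f))) (S23_ext V (S13 V abc)))
         R
    & hmap (tmap diag id) R = lhs.
Proof.
move=> abc lhs.
have lS := sfS_linear V; have lY := sfY_linear V; have hY := sfY_laurent V.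
have lF p := @fY_hlinear K W V f p; have lP := lprod_hlinear V f charK.
have lP1 := lext_hlinear (C := W) lP.
have lP2 := lext_hlinear (C := laurent K) lP1.
have lj (B : lmodType K) j := @dpcoef_linear K B j.
pose s := S23_ext V (S13 V abc).
(* Y(z) is extended successively by the factor of c, the Laurent factor of x and that of x1. *)
pose Y1 t n : {fps W ⊗ W} := htensr (sfY V ^~ n) t.
pose Y2 t n : {fps W ⊗ W ⊗ laurent K} := htensr (Y1 ^~ n) t.
pose Y3 t n : {fps W ⊗ W ⊗ laurent K ⊗ laurent K} := htensr (Y2 ^~ n) t.
have lY1 n : hlinear (Y1^~ n) by apply: htensr_hlinear.
have lY2 n : hlinear (Y2^~ n) by apply: htensr_hlinear.
have hY1 t : hlaurent (Y1 t) by apply: htensr_hlaurent.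
have hY2 t : hlaurent (Y2 t) by apply: htensr_hlaurent.
have hY3 t : hlaurent (Y3 t) by apply: htensr_hlaurent.
have F1 p : htensr (fun t => fY V f t p) = fun t => fmul f (Y1 t) p.
  by apply/funext => t; apply: htensr_fmul.
have F2 p : htensr (htensr (fun t => fY V f t p)) = fun t => fmul f (Y2 t) p.
  by rewrite F1; apply/funext => t; apply: htensr_fmul.
have F3 p : htensr (htensr (htensr (fun t => fY V f t p))) =
    fun t => fmul f (Y3 t) p.
  by rewrite F2; apply/funext => t; apply: htensr_fmul.
(* Taking the coefficient of lambda^j / j! commutes with each added factor and leaves the
   coefficient of z^(-1-j) of f Y. *)
have P1 j : hmap (dpcoef j) \o lprod V f = fun t => fY V f t (-1 - j%:Z).
  by apply/funext => t; apply: lprod_dpcoef.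
have P2 j : hmap (dpcoef j) \o lext (C := W) (lprod V f) =
    htensr (fun t => fY V f t (-1 - j%:Z)).
  by apply/funext => t; rewrite /= dpcoef_lext// P1.
have P3 j : hmap (dpcoef j) \o
      lext (C := laurent K) (lext (C := W) (lprod V f)) =
    htensr (htensr (fun t => fY V f t (-1 - j%:Z))).
  by apply/funext => t; rewrite /= dpcoef_lext// P2.
have P4 j : hmap (dpcoef j) \o
      lext (C := laurent K) (lext (C := laurent K) (lext (C := W) (lprod V f))) =
    htensr (htensr (htensr (fun t => fY V f t (-1 - j%:Z)))).
  by apply/funext => t; rewrite /= dpcoef_lext// P3.
(* [e l] takes the coefficient of z^l after x1 becomes x1 + z, then sets x1 = x. *)
pose e (B : lmodType K) l : B ⊗ laurent K ⊗ laurent K -> B ⊗ laurent K :=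
  diag \o tmap id (liota l).
have li (B : lmodType K) l : linear (tmap (@id B) (@liota K l)).
  by apply: tmap_linear => //; apply: liota_linear.
have le (B : lmodType K) l : linear (e B l).
  by apply: lin_comp; [apply: diag_linear | apply: li].
have pE j l : -1 - (j + l)%N%:Z = -1 - j%:Z - l%:Z :> int.
  by rewrite PoszD opprD addrA.
have S23l l t : S23_ext V (hmap (tmap id (liota l)) t) =
    hmap (tmap id (liota l)) (S23_ext V t).
  by apply: htensr_hmap_tmap; [apply: S23_hlinear | apply: liota_linear].
(* Moving [e l] outside the state-field map gives the hexagon the shape required by [fmul_hsum]. *)
have gen l (F : {fps W ⊗ W} -> {fps W}) : hlinear F ->
    htensr (htensr F) (hmap diag (hmap (tmap id (liota l)) s)) =
    hmap (@e _ l) (htensr (htensr (htensr F)) s).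
  move=> lF'; rewrite htensr_diag; last exact: htensr_hlinear.
  rewrite htensr_hmap_tmap//; last exact: liota_linear.
  by apply: htensr_hlinear; apply: htensr_hlinear.
pose x n := sfS V (Y1 abc n).
have hex n : hsum (fun l => hmap (@e _ l) (Y3 s (n - l%:Z))) (x n).
  have := hexV abc n; congr hsum; apply/funext => l.
  by rewrite S23l gen.
have lhsE j : hmap (dpcoef j) lhs = fmul f x (-1 - j%:Z).
  rewrite dpcoef_htensr// dpcoef_htens lprod_dpcoef//.
  rewrite -(htensr_htens _ _ (lF _)) F1 (hlinear_fmul _ _ lS)//.
set T := (X in hsum X lhs).
have TE j l : hmap (dpcoef j) (T l) =
    hmap (@e _ l) (fmul f (Y3 s) (-1 - j%:Z - l%:Z)).
  have XE : (l`!)%:R^-1 *: iter l (hmap dx) (S13 V abc) =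
      hmap (tmap id (liota l)) (S13 V abc).
    by apply/funext => k; rewrite /hmap -dx_liota -iter_hmap.
  rewrite /T XE S23l -pE -(congr1 (@^~ s) (F3 _)) -gen// -P3.
  apply/funext => k; rewrite /= /hmap -dpcoef_iter_dlambda; congr dpcoef.
  exact: iter_hmap.
have Tlhs : hsum T lhs.
  (* All indices -1 - j are at most -1, so the uniformity in p yields one [N] for all powers of
     lambda. *)
  move=> M; have [N hN] := fmul_hsum f (@le _) (hY3 s) hex (-1) M.
  exists N => n nN k kM; apply: dpcoef_inj => // j.
  rewrite (lin_sum _ _ _ (lj _ j)) -[RHS]/(hmap (dpcoef j) lhs k) lhsE.
  rewrite -(hN n)//; last by rewrite gerBl.
  by apply: eq_bigr => l _; rewrite -TE.
split=> //.
set u := lext _ _; set D := (X in hexp X u).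
pose T' l : {fps W ⊗ W ⊗ laurent K ⊗ laurent K ⊗ {poly K}} :=
  (l`!)%:R^-1 *: iter l D u.
have T'E j l k : dpcoef j (T' l k) = tmap id (liota l) (dpcoef (j + l) (u k)).
  rewrite -dpcoef_iter_exp; congr dpcoef; rewrite /T' fctE; congr (_ *: _).
  exact: (iter_hmap (fun w => dlambda (tmap dx id w))).
(* Each h-coefficient of [u] is polynomial in lambda, so high powers of d_lambda kill it and the
   exponential series is finite there. *)
have [R hR] : exists R, hsum T' R.
  apply: hsum_exists => k; have [N hN] := dpcoef_eventually0 (u k).
  exists N => l Nl; apply: dpcoef_inj => // j.
  rewrite T'E hN ?(leq_trans Nl) ?leq_addl//.
  by rewrite (lin0 (li _ _)) (lin0 (lj _ _)).
exists R; first exact: hR.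
apply/funext => k.
have lt := tmap_linear (@diag_linear K (W ⊗ W)%type) (@lin_id K {poly K}).
(* Setting x1 = x turns the exponential series into the first series term by term, so the limits
   agree. *)
have T'T l : tmap diag id (T' l k) = T l k.
  apply: dpcoef_inj => // j; rewrite dpcoef_tmap; last exact: diag_linear.
  rewrite T'E -[RHS]/(hmap (dpcoef j) (T l) k) TE -pE.
  by rewrite -(congr1 (@^~ s) (F3 _)) -P4.
have [N1 h1] := Tlhs k.+1; have [N2 h2] := hR k.+1.
rewrite /hmap -(h1 (maxn N1 N2) (leq_maxl _ _) k (ltnSn k)).
rewrite -(h2 (maxn N1 N2) (leq_maxr _ _) k (ltnSn k)) (lin_sum _ _ _ lt).
by apply: eq_bigr => l _; rewrite T'T.
Qed.
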